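(* For all $n\geqslant 4$, the function $\mathrm{dmaj}\in F(S^D_n)$ is induced by $\mathrm{maj}\in F(S_n)$.
   Context: For a finite Coxeter system $(W,S)$ with length $\ell$ and identity $e$, $F(W)$ is the set of functions $W\to\mathbb{Z}$, and $[\ell]$ is the set of $f\in F(W)$ that are equidistributed with $\ell$ (i.e. $\sum_{w\in W}q^{f(w)}=\sum_{w\in W}q^{\ell(w)}$) and satisfy $f(e)=0$ and $f(w_0)=\ell(w_0)$, where $w_0$ is the element of maximal length. For $J\subseteq S$, $W_J$ is the subgroup generated by $J$, $W^J=\{w\in W:\ell(ws)>\ell(w)\ \forall s\in J\}$, $\ell_J$ is the length of $(W_J,J)$ (the restriction of $\ell$), and each $w\in W$ factors uniquely as $w=w^Jw_J$ with $w^J\in W^J$, $w_J\in W_J$, $\ell(w)=\ell(w^J)+\ell(w_J)$. A function $f\in[\ell]$ is induced by $g\in F(W_J)$ if $g\in[\ell_J]$ and $f(w)=\ell(w^J)+g(w_J)$ for all $w\in W$. For a sequence $\sigma=(\sigma(1),\dots,\sigma(n))$ of integers, $\mathrm{maj}(\sigma)=\sum_{i\in[n-1],\,\sigma(i)>\sigma(i+1)}i$ and $\mathrm{Neg}(\sigma)=\{i\in[n]:\sigma(i)<0\}$. $S_n^D$ is the group of bijections $w$ of $[\pm n]=\{-n,\dots,-1,1,\dots,n\}$ with $w(-a)=-w(a)$ and $|\mathrm{Neg}(w)|$ even, written as sequences $(w(1),\dots,w(n))$; it is a Coxeter group with generators $s_0=(-2,-1,3,\dots,n)$ and $s_i=(1,\dots,i-1,i+1,i,i+2,\dots,n)$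 for $1\le i\le n-1$, with length $\ell_D$. Here $J=\{s_1,\dots,s_{n-1}\}$, and $S_n$ is identified with the parabolic subgroup generated by $J$. The D-negative major index is $\mathrm{dmaj}(\sigma)=\mathrm{maj}(\sigma)-\sum_{i\in\mathrm{Neg}(\sigma)}\sigma(i)-|\mathrm{Neg}(\sigma)|$ for $\sigma\in S_n^D$. *)

(* Defs.v *)
From HB Require Import structures.
From mathcomp Require Import all_boot all_order all_algebra all_fingroup.

Set Implicit Arguments.
Unset Strict Implicit.
Unset Printing Implicit Defensive.

Import GroupScope Order.TTheory GRing.Theory Num.Theory.

(* In this part gT is the Coxeter group W, S its set of simple reflections
   (so <<S>> is all of gT), F(W) is gT -> int, and for J \subset S, F(W_J) is
   [subg <<J>>] -> int.  The definitions only involve W and S. *)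

Section Length.

Variables (gT : finGroupType) (S : {set gT}).
Implicit Types (w : gT) (k : nat).

Definition is_word w k : bool :=
  [exists t : k.-tuple gT, all [in S] t && (\prod_(s <- t) s == w)].

Fact length_subproof w : exists k, (w \in <<S>>) ==> is_word w k.
Proof.
case: (boolP (w \in <<S>>)) => [|_]; last by exists 0%N.
case/gen_prodgP=> k [c Sc ->]; exists k => /=.
apply/existsP; exists [tuple c i | i < k]; apply/andP; split.
  by apply/allP => s /tnthP[i ->]; rewrite tnth_mktuple Sc.
by rewrite big_tuple; apply/eqP/eq_bigr => i _; rewrite tnth_mktuple.
Qed.

(* The junk value outside <<S>> is 0. *)
Definition length w : nat := ex_minn (length_subproof w).

Lemma lengthP w : w \in <<S>> ->
  is_word w (length w) /\ forall k, is_word w k -> (length w <= k)%N.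
Proof.
move=> Sw; rewrite /length; case: ex_minnP => m; rewrite Sw /= => wm minm.
by split.
Qed.

(* Integer-valued functions have generating functions in Z[q, 1/q]; the
   equality is stated in its fraction field Q(q), with q = 'X. *)
Definition gen_fun (f : gT -> int) : {fraction {poly int}} :=
  (\sum_(w : gT) (FracField.tofrac 'X) ^ f w)%R.

Definition equidistributed (f g : gT -> int) : Prop := gen_fun f = gen_fun g.

(* In a finite Coxeter group exactly one element, w_0, is longest. *)
Definition longest w : Prop := forall v, (length v <= length w)%N.

Definition len_class (f : gT -> int) : Prop :=
  [/\ equidistributed f (fun w => Posz (length w)),
      f 1 = 0%R &
      forall w0, longest w0 -> f w0 = Posz (length w0)].

Definition min_coset_reps (J : {set gT}) : {set gT} :=
  [set w | [forall s in J, (length w < length (w * s))%N]].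

End Length.

Section Induced.

Variables (gT : finGroupType) (S J : {set gT}).

(* J, seen as a generating set of the group W_J itself. *)
Definition parabolic_gens : {set [subg <<J>>]} := sgval @^-1: J.

(* u and v are w^J and w_J: the factorisation w = w^J w_J is unique. *)
Definition induced_by (f : gT -> int) (g : [subg <<J>>] -> int) : Prop :=
  [/\ len_class S f, len_class parabolic_gens g &
      forall w : gT, exists (u : gT) (v : [subg <<J>>]),
        [/\ u \in min_coset_reps S J, w = u * sgval v &
            f w = (Posz (length S u) + g v)%R]].

End Induced.

(* Sequences are indexed from 1, as in sigma = (sigma(1), ..., sigma(n)). *)
Definition entry (s : seq int) (i : nat) : int := nth 0%R s i.-1.

Definition maj (s : seq int) : nat :=
  (\sum_(1 <= i < size s | (entry s i.+1 < entry s i)%R) i)%N.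

Definition Neg (s : seq int) : seq nat :=
  [seq i <- iota 1 (size s) | (entry s i < 0)%R].

Definition dmaj (s : seq int) : int :=
  (Posz (maj s) - \sum_(i <- Neg s) entry s i - Posz (size (Neg s)))%R.

(* The set {-n, ..., -1, 1, ..., n}: (b, i) stands for i + 1 if b is false, - (i + 1) otherwise. *)
Definition letter (n : nat) : Type := (bool * 'I_n)%type.
HB.instance Definition _ n := Finite.on (letter n).

Section SignedPerm.

Variable n : nat.
Implicit Types (a : letter n) (i : 'I_n).

Definition letter_val a : int :=
  if a.1 then (- Posz a.2.+1)%R else Posz a.2.+1.

Definition letter_opp a : letter n := (~~ a.1, a.2).

Lemma letter_val_opp a : letter_val (letter_opp a) = (- letter_val a)%R.
Proof. by case: a => [[] i]; rewrite /letter_val //= opprK. Qed.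

Lemma letter_val_inj : injective letter_val.
Proof. by move=> [[] i] [[] j] //= [/val_inj->]. Qed.

Lemma letter_valP (x : int) :
  reflect (exists a, letter_val a = x) (0 < `|x| <= n)%N.
Proof.
apply: (iffP idP) => [|[[[] i] <-]]; try by case: i.
case: x => [[|k]|k] //= lekn; first by exists (false, Ordinal lekn).
by exists (true, Ordinal lekn); rewrite /= NegzE.
Qed.

Definition perm_window (w : {perm letter n}) : seq int :=
  [seq letter_val (w (false, i)) | i <- enum 'I_n].

Definition even_signed (w : {perm letter n}) : bool :=
  [forall a, w (letter_opp a) == letter_opp (w a)]
  && ~~ odd (size (Neg (perm_window w))).

Lemma even_signedP (w : {perm letter n}) : reflect
  ((forall a, w (letter_opp a) = letter_opp (w a)) /\
   \big[addb/false]_i (w (false, i)).1 = false) (even_signed w).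
Proof.
have ->: \big[addb/false]_i (w (false, i)).1
       = odd (size (Neg (perm_window w))).
  rewrite /Neg size_filter /perm_window size_map size_enum_ord.
  rewrite -[1%N]addn0 iotaDl count_map.
  transitivity (odd (count (fun i => (w (false, i)).1) (enum 'I_n))).
    rewrite -big_enum /=; elim: (enum _) => [|i s IHs]; first by rewrite big_nil.
    by rewrite big_cons IHs /= oddD oddb.
  congr (odd _); rewrite -val_enum_ord count_map.
  apply: eq_count => i /=.
  rewrite /entry /= (nth_map i) ?size_enum_ord ?ltn_ord //.
  rewrite (nth_ord_enum i i).
  by rewrite /letter_val; case: (w _) => [[] j].
apply: (iffP andP) => [[/forallP wN /negbTE->]|[wN ->]].
  by split=> // a; apply/eqP.
by split=> //; apply/forallP => a; rewrite wN.
Qed.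

(* The group S_n^D. *)
Definition SD : Type := {w : {perm letter n} | even_signed w}.
HB.instance Definition _ := SubFinite.on SD.

Lemma signed_false (w : {perm letter n}) :
    (forall a, w (letter_opp a) = letter_opp (w a)) ->
  forall a, w a = (a.1 (+) (w (false, a.2)).1, (w (false, a.2)).2).
Proof.
move=> wN [[] i] /=; last by case: (w _).
by rewrite -[(true, i)]/(letter_opp (false, i)) wN.
Qed.

Lemma signed_sum (w : {perm letter n}) (F : 'I_n -> bool) :
    (forall a, w (letter_opp a) = letter_opp (w a)) ->
  \big[addb/false]_i F (w (false, i)).2 = \big[addb/false]_i F i.
Proof.
move=> wN; symmetry; apply: (reindex_inj (h := fun i => (w (false, i)).2)) => //.
move=> i j eqij; case: (eqVneq (w (false, i)).1 (w (false, j)).1) => [eq1|ne1].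
  suff [] : (false, i) = (false, j) :> letter n by [].
  by apply: (@perm_inj _ w); apply: injective_projections.
suff: (false, i) = (true, j) :> letter n by [].
apply: (@perm_inj _ w); rewrite [RHS]signed_false //=.
by apply: injective_projections => //=; case: (w _).1 (w _).1 ne1 => [] [].
Qed.

(* {perm T} composes from left to right, so this is the usual composition:
   (u v)(a) = u(v(a)). *)
Lemma SD_mul_subproof (u v : SD) : even_signed (val v * val u).
Proof.
have [uN u0] := even_signedP _ (valP u); have [vN v0] := even_signedP _ (valP v).
apply/even_signedP; split=> [a|]; first by rewrite !permM vN uN.
under eq_bigr => i _ do rewrite permM signed_false //=.
by rewrite big_split /= v0 (signed_sum (fun i => (val u (false, i)).1)) // u0.
Qed.

Lemma SD_one_subproof : even_signed 1.
Proof.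
apply/even_signedP; split=> [a|]; first by rewrite !perm1.
by rewrite big1 // => i _; rewrite perm1.
Qed.

Lemma SD_inv_subproof (u : SD) : even_signed (val u)^-1.
Proof.
have [uN u0] := even_signedP _ (valP u).
have vN a : (val u)^-1 (letter_opp a) = letter_opp ((val u)^-1 a).
  by apply: (@perm_inj _ (val u)); rewrite uN !permKV.
apply/even_signedP; split=> //.
rewrite -(signed_sum (fun i => ((val u)^-1 (false, i)).1) uN) -[RHS]u0.
apply: eq_bigr => i _.
have := permK (val u) (false, i); rewrite (signed_false vN) => -[+ _].
by case: (_.1) (_.1) => [] [].
Qed.

Definition SD_mul (u v : SD) : SD := exist even_signed _ (SD_mul_subproof u v).
Definition SD_one : SD := exist even_signed _ SD_one_subproof.
Definition SD_inv (u : SD) : SD := exist even_signed _ (SD_inv_subproof u).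

Lemma SD_mulA : associative SD_mul.
Proof. by move=> u v w; apply: val_inj; rewrite /= mulgA. Qed.
Lemma SD_mul1 : left_id SD_one SD_mul.
Proof. by move=> u; apply: val_inj; rewrite /= mulg1. Qed.
Lemma SD_mulV : left_inverse SD_one SD_inv SD_mul.
Proof. by move=> u; apply: val_inj; rewrite /= mulgV. Qed.

HB.instance Definition _ := Finite_isGroup.Build SD SD_mulA SD_mul1 SD_mulV.

(* The sequence (w(1), ..., w(n)). *)
Definition window (w : SD) : seq int := perm_window (val w).

Lemma SD_mulE (u v : SD) a : val (u * v) a = val u (val v a).
Proof. by rewrite permM. Qed.

Lemma window_inj : injective window.
Proof.
move=> u v /eq_in_map eq_uv; apply: val_inj; apply/permP => a.
have [uN _] := even_signedP _ (valP u); have [vN _] := even_signedP _ (valP v).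
rewrite (signed_false uN) (signed_false vN).
by rewrite (letter_val_inj (eq_uv a.2 _)) ?mem_enum.
Qed.

(* (-2, -1, 3, ..., n) *)
Definition s0_window : seq int :=
  [:: - 2%:Z; - 1%:Z]%R ++ [seq Posz k | k <- iota 3 (n - 2)].

(* (1, ..., i - 1, i + 1, i, i + 2, ..., n) *)
Definition s_window (i : nat) : seq int :=
  [seq Posz k | k <- iota 1 i.-1 ++ [:: i.+1; i] ++ iota i.+2 (n - i.+1)].

Definition SD_J : {set SD} :=
  [set w | [exists i : 'I_n, (0 < i)%N && (window w == s_window i)]].

Definition SD_S : {set SD} := [set w | window w == s0_window] :|: SD_J.

Definition swap (b : bool) (i j : 'I_n) (a : letter n) : letter n :=
  (a.1 (+) (b && (a.2 \in [:: i; j])), tperm i j a.2).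

Lemma swapK b i j : involutive (swap b i j).
Proof.
move=> [c k]; rewrite /swap /= tpermK; congr (_, _).
have ->: (tperm i j k \in [:: i; j]) = (k \in [:: i; j]).
  rewrite !inE; case: tpermP => [->|->|/eqP/negbTE-> /eqP/negbTE->] //;
  by rewrite !eqxx ?orbT.
by rewrite -addbA addbb addbF.
Qed.

Lemma swap_even b i j : i != j -> even_signed (perm (inv_inj (swapK b i j))).
Proof.
move=> neij; apply/even_signedP; split=> [a|].
  by rewrite !permE /swap /letter_opp /= addNb.
under eq_bigr => k _ do rewrite permE /= inE.
rewrite (bigD1 i) // (bigD1 j) 1?eq_sym //= big1 ?addbF.
  by rewrite !inE !eqxx orbT addbb.
by move=> k /andP[/negbTE ki /negbTE kj]; rewrite !inE ki kj andbF.
Qed.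

Definition SD_swap b i j (neij : i != j) : SD :=
  exist even_signed _ (swap_even b neij).

Lemma nth_window_swap b i j (neij : i != j) (k : 'I_n) :
  nth 0%R (window (SD_swap b neij)) k
  = letter_val (b && (k \in [:: i; j]), tperm i j k).
Proof.
rewrite (nth_map k) ?size_enum_ord // (nth_ord_enum k k) permE.
by rewrite /swap.
Qed.

Lemma ex_s_window (i : 'I_n) : (0 < i)%N -> exists w, window w = s_window i.
Proof.
case: i => -[|i] //= lt_in _.
have lt_i1n : (i < n)%N by apply: ltnW.
pose a := Ordinal lt_i1n; pose b := Ordinal lt_in.
have neab : a != b by rewrite -val_eqE /= neq_ltn ltnSn.
exists (SD_swap false neab); apply: (@eq_from_nth _ 0%R).
  rewrite size_map size_enum_ord size_map !size_cat !size_iota.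
  by rewrite addnA addn2 subnKC.
move=> k; rewrite size_map size_enum_ord => lt_kn.
rewrite -[k]/(val (Ordinal lt_kn)) nth_window_swap /letter_val /=.
rewrite (nth_map 0%N); last first.
  by rewrite !size_cat !size_iota /= addnA addn2 subnKC.
congr Posz; rewrite nth_cat size_iota.
case: (ltngtP k i) => [ltki|ltik|eqki].
- rewrite nth_iota // tpermD //= -val_eqE /= neq_ltn.
    by rewrite ltki orbT.
  by rewrite (leqW ltki) orbT.
- rewrite nth_cat /=; case: (ltngtP k i.+1) => [|lt|eqk].
  + by rewrite ltnNge ltik.
  + have le2 : (2 <= k - i)%N by rewrite leq_subRL ?addn2 // ltnW.
    rewrite ltnNge le2 /= nth_iota; last first.
      by rewrite -subnDA addn2 ltn_sub2r // (leq_ltn_trans lt).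
    rewrite -subnDA addn2 tpermD /=.
    * by rewrite addSn subnKC.
    * by rewrite -val_eqE /= neq_ltn ltik.
    * by rewrite -val_eqE /= neq_ltn lt.
  + have ->: Ordinal lt_kn = b by apply: val_inj.
    by rewrite tpermR eqk subSnn.
- have ->: Ordinal lt_kn = a by apply: val_inj.
  by rewrite tpermL eqki subnn.
Qed.

Lemma ex_s0_window : (2 <= n)%N -> exists w, window w = s0_window.
Proof.
move=> le2n; pose a := Ordinal (ltnW le2n); pose b := Ordinal le2n.
have neab : a != b by [].
exists (SD_swap true neab); apply: (@eq_from_nth _ 0%R).
  by rewrite size_map size_enum_ord /= size_map size_iota -[_.+2]add2n subnKC.
move=> k; rewrite size_map size_enum_ord => lt_kn.
rewrite -[k]/(val (Ordinal lt_kn)) nth_window_swap /letter_val /=.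
case: k lt_kn => [|[|k]] lt_kn /=.
- have ->: Ordinal lt_kn = a by apply: val_inj.
  by rewrite tpermL.
- have ->: Ordinal lt_kn = b by apply: val_inj.
  by rewrite tpermR.
have lt_k : (k < n - 2)%N by rewrite ltn_subRL.
by rewrite tpermD //= (nth_map 0%N) ?size_iota // nth_iota.
Qed.

End SignedPerm.

(* Main.v *)
Require Import Defs.
From mathcomp Require Import all_boot all_order all_algebra all_fingroup.
From mathcomp Require Import ring zify.

Set Implicit Arguments.
Unset Strict Implicit.
Unset Printing Implicit Defensive.

Import GroupScope Order.TTheory GRing.Theory Num.Theory.

(** Write inv for the number of inversions of a sequence and nsp for its number
    of pairs of entries with negative sum.  The length of an element of S_n^D is
    inv + nsp of its window, and that of an element of S_n is inv ([length_D],
    [length_J]).  A pair has negative sum exactly when its entry of larger absolute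
    value is negative, and in a signed permutation a negative entry - k is that
    entry in k - 1 pairs.  So the correction term in dmaj, which is the sum of these
    k - 1, equals nsp ([nsp_Neg]), and dmaj = maj + nsp.

    Right multiplication by S_n permutes the positions of a window, which leaves
    nsp unchanged, and every coset w S_n consists of all the rearrangements of the
    window of w ([J_perm], [J_transitive]).  Hence dmaj and the length are
    equidistributed as soon as, on the rearrangements of any sequence of distinct
    integers, maj and inv are: this is MacMahon's theorem ([sum_maj_inv]), proved
    by inserting the largest letter at all places.  An element of maximal length
    has a decreasing window, since exchanging an adjacent ascent would increase
    inv; on a decreasing sequence every position is a descent and every pair is an
    inversion, so that maj = inv there.

    Finally, sorting the window of w writes w = u v with u of increasing window,
    hence of length nsp, and v in S_n.  As u is increasing on 1, ..., n, the windows
    of w and v have the same descents; so dmaj w = nsp u + maj v = length u + maj v. *)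

(** * Statistics on sequences *)

Fixpoint npairs (T : Type) (r : rel T) (s : seq T) : nat :=
  if s is x :: t then (count (r x) t + npairs r t)%N else 0%N.

Lemma npairs_rcons (T : Type) (r : rel T) s x :
  npairs r (rcons s x) = (npairs r s + count (r^~ x) s)%N.
Proof.
elim: s => [|y s IHs] //=.
by rewrite IHs -cats1 count_cat /= addn0; lia.
Qed.

(** Exchanging two neighbours reorders no other pair.  The additive form avoids
    truncated subtraction. *)
Lemma npairs_swap (T : Type) (r : rel T) p x y t :
  (npairs r (p ++ [:: x, y & t]) + r y x =
   npairs r (p ++ [:: y, x & t]) + r x y)%N.
Proof.
elim: p => [|z p IHp] /=; first by lia.
by rewrite !count_cat /=; lia.
Qed.

Lemma npairs_perm (T : eqType) (r : rel T) s t :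
  symmetric r -> perm_eq s t -> npairs r s = npairs r t.
Proof.
move=> rC; elim: s t => [|x s IHs] t.
  by rewrite perm_sym => /perm_nilP->.
move=> eq_st; have xt: x \in t by rewrite -(perm_mem eq_st) mem_head.
case/splitPr: xt eq_st => t1 t2.
rewrite -[x :: t2]cat1s perm_sym perm_catCA perm_cons perm_sym => eq_s.
rewrite /= (IHs _ eq_s) (seq.permP eq_s) {IHs eq_s}.
elim: t1 => //= y t1 <-.
by rewrite !count_cat /= rC; lia.
Qed.

Lemma unsorted (T : Type) (r : rel T) s : ~~ sorted r s ->
  exists p x y t, s = p ++ [:: x, y & t] /\ ~~ r x y.
Proof.
elim: s => [|x [|y s] IHs] //=.
rewrite negb_and; case rxy: (r x y) => /=; last first.
  by exists [::], x, y, s; rewrite rxy.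
by case/IHs=> p [x' [y' [t [-> nr]]]]; exists (x :: p), x', y', t.
Qed.

(** The two statistics are instances of [npairs]: general lemmas on adjacent
    exchanges and rearrangements then serve both. *)
Notation inv := (npairs (fun x y : int => (y < x)%R)).

Notation nsp := (npairs (fun x y : int => (x + y < 0)%R)).

Lemma nsp_perm s t : perm_eq s t -> nsp s = nsp t.
Proof. by apply: npairs_perm => x y; rewrite addrC. Qed.

Lemma inv_sorted s : sorted <%R s -> inv s = 0%N.
Proof.
elim: s => //= x s IHs xs; rewrite IHs ?(path_sorted xs) // addn0.
apply/eqP; rewrite -leqn0 leqNgt -has_count; apply/hasPn => y ys.
rewrite -leNgt ltW //.
by have /allP/(_ _ ys) := order_path_min lt_trans xs.
Qed.

Lemma maj_rcons s x :
  maj (rcons s x) = (maj s + (x < last x s)%R * size s)%N.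
Proof.
rewrite /maj size_rcons; case: (lastP s) => [|s' y].
  by rewrite !big_geq // muln0.
rewrite last_rcons size_rcons big_mkcond big_nat_recr //= [in RHS]big_mkcond /=.
congr addn; last first.
  rewrite /entry /= !nth_rcons !size_rcons ltnn ltnSn !eqxx ltnn.
  by case: (_ < _)%R; rewrite ?mul1n ?mul0n.
apply: eq_big_nat => -[|i] //= lt_is.
by rewrite /entry /= !(nth_rcons _ (rcons s' y)) !size_rcons lt_is (ltnW lt_is).
Qed.

(** Only comparisons between entries matter for maj. *)
Lemma maj_map (g : int -> int) s :
  {in s &, {mono g : x y / (x < y)%R}} -> maj (map g s) = maj s.
Proof.
move=> gP; rewrite /maj size_map big_mkcond [in RHS]big_mkcond /=.
apply: eq_big_nat => -[|i] //= lt_is.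
by rewrite /entry /= !(nth_map 0%R) ?gP ?mem_nth // ltnW.
Qed.

Lemma maj_decreasing s : sorted >%R s -> maj s = inv s.
Proof.
elim/last_ind: s => [|s x IHs]; first by rewrite /maj big_geq.
move=> ss; have [ss' lastx] : sorted >%R s /\ all (> x)%R s.
  move: ss; rewrite !(sorted_pairwise (rev_trans lt_trans)) -cats1.
  by rewrite pairwise_cat allrel1r => /and3P[].
rewrite maj_rcons npairs_rcons IHs //; congr addn.
move: (lastx); rewrite all_count => /eqP->.
case: (lastP s) lastx => [|s' y]; first by rewrite muln0.
by rewrite last_rcons all_rcons => /andP[-> _]; rewrite mul1n.
Qed.
(** * MacMahon's theorem *)

Definition ins (T : Type) (M : T) p s := take p s ++ M :: drop p s.

Lemma ins_rcons (T : Type) (M : T) p s x : (p <= size s)%N ->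
  ins M p (rcons s x) = rcons (ins M p s) x.
Proof.
move=> le_ps; rewrite /ins -cats1 takel_cat // drop_cat.
case: ltngtP le_ps => // [lt_ps|->] _; rewrite -cats1 -catA //.
by rewrite subnn drop_size.
Qed.

Lemma ins_size (T : Type) (M : T) s : ins M (size s) s = rcons s M.
Proof. by rewrite /ins take_size drop_size cats1. Qed.

Lemma last_ins (T : Type) (M : T) p s x : (p < size s)%N ->
  last x (ins M p s) = last x s.
Proof.
move=> lt_ps; rewrite /ins last_cat /= -[in RHS](cat_take_drop p s) last_cat.
by case: (drop p s) (size_drop p s) => [|//] /=; lia.
Qed.

Lemma perm_ins (T : eqType) (M : T) p s : perm_eq (ins M p s) (M :: s).
Proof.
rewrite /ins -[M :: drop p s]cat1s perm_catCA perm_cons.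
by rewrite cat_take_drop.
Qed.

(** A rearrangement with a new letter M arises from exactly one rearrangement
    without it and one insertion place: these are found by deleting M and by
    reading off its position. *)
Lemma perm_permutations_rcons (T : eqType) (M : T) s : M \notin s ->
  perm_eq (permutations (rcons s M))
          [seq ins M p t | t <- permutations s, p <- iota 0 (size s).+1].
Proof.
move=> sM; apply: uniq_perm; first exact: permutations_uniq.
  apply: allpairs_uniq; rewrite ?permutations_uniq ?iota_uniq //.
  move=> _ _ /allpairsP[[t p] [+ + ->]] /allpairsP[[u r] [+ + ->]] /=.
  rewrite !mem_permutations !mem_iota !add0n !ltnS /=.
  move=> eq_ts le_p eq_us le_r eq_ins.
  have idx k v : perm_eq v s -> (k <= size s)%N ->
      index M (ins M k v) = k /\ rem M (ins M k v) = v.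
    move=> eq_vs le_k; have vM : M \notin take k v.
      by apply: contra sM => /mem_take; rewrite (perm_mem eq_vs).
    rewrite /ins index_cat (negbTE vM) /= eqxx addn0.
    rewrite size_takel ?(perm_size eq_vs) //.
    split=> //; rewrite remE index_cat (negbTE vM) /= eqxx addn0 take_size_cat //.
    by rewrite drop_cat ltnNge leqnSn /= subSnn /= drop0 cat_take_drop.
  have [ip <-] := idx _ _ eq_ts le_p; have [ir <-] := idx _ _ eq_us le_r.
  by rewrite eq_ins -ip -ir eq_ins.
move=> t; rewrite mem_permutations perm_sym perm_rcons perm_sym.
apply/idP/allpairsP.
  move=> eq_t; have Mt: M \in t by rewrite (perm_mem eq_t) mem_head.
  case/splitPr: Mt eq_t => t1 t2 eq_t; exists (t1 ++ t2, size t1).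
  move: eq_t; rewrite -[M :: t2]cat1s perm_catCA perm_cons => eq_t.
  rewrite mem_permutations mem_iota add0n ltnS -(perm_size eq_t) size_cat.
  rewrite leq_addr /=.
  by split; rewrite ?leq_addr // /ins take_size_cat // drop_size_cat.
case=> -[u p] /= [+ _ ->]; rewrite mem_permutations => eq_us.
by rewrite (perm_trans (perm_ins _ _ _)) // perm_cons.
Qed.

Section MacMahon.
Variables (R : comNzRingType) (q : R).
Local Open Scope ring_scope.

(** The major index rises by each of 0, ..., |s| exactly once when the maximum
    is inserted at all places.  Induct on the last letter x: an insertion that is
    not next to x neither creates nor destroys a descent just before x, but
    shifts its position by one; the two insertions next to x are computed
    directly. *)
Lemma sum_ins_maj (M : int) s : all (< M) s ->
  \sum_(p < (size s).+1) q ^+ maj (ins M p s)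
  = q ^+ maj s * \sum_(i < (size s).+1) q ^+ i.
Proof.
elim/last_ind: s => [|s x IHs].
  by rewrite !big_ord1 /ins /= /maj !big_geq // expr0 mulr1.
rewrite all_rcons => /andP[/= xM sM]; move: (IHs sM) => {}IHs.
have ins_end : ins M (size s).+1 (rcons s x) = rcons (rcons s x) M.
  by rewrite -(size_rcons s x) ins_size.
rewrite size_rcons big_ord_recr big_ord_recr /= ins_end (maj_rcons _ M).
rewrite ins_rcons // ins_size maj_rcons size_rcons last_rcons xM mul1n.
have -> : (M < last M (rcons s x)) = false by rewrite last_rcons ltNge ltW.
rewrite maj_rcons mul0n addn0.
have lastM : (M < last M s) = false.
  case: (lastP s) sM => [|s' y]; first by rewrite ltxx.
  by rewrite all_rcons last_rcons => /andP[lt_yM _]; rewrite ltNge ltW.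
under eq_bigr => p _.
  rewrite (ins_rcons _ _ (ltnW (ltn_ord p))) maj_rcons last_ins //.
  rewrite (perm_size (perm_ins _ _ _)) exprD.
  over.
rewrite -mulr_suml; move: IHs; rewrite big_ord_recr /= ins_size (maj_rcons _ M).
rewrite lastM mul0n addn0 => /(canRL (addrK _)) ->.
have qS k : \sum_(i < k.+1) q ^+ i = q * (\sum_(i < k) q ^+ i) + 1.
  rewrite big_ord_recl expr0 addrC mulr_sumr; congr (_ + _).
  by apply: eq_bigr => i _; rewrite -exprS.
have qSr k : \sum_(i < k.+1) q ^+ i = \sum_(i < k) q ^+ i + q ^+ k.
  by rewrite big_ord_recr.
rewrite (maj_rcons s x); case: (x < _).
  by rewrite !mul1n (qS (size s).+1) !exprD exprS; ring.
by rewrite !mul0n addn0 expr0 (qSr (size s).+1) exprD; ring.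
Qed.

(** Here M creates one inversion with each letter on its right. *)
Lemma sum_ins_inv (M : int) s : all (< M) s ->
  \sum_(p < (size s).+1) q ^+ inv (ins M p s)
  = q ^+ inv s * \sum_(i < (size s).+1) q ^+ i.
Proof.
elim/last_ind: s => [|s x IHs].
  by rewrite !big_ord1 /ins /= !expr0 mulr1.
rewrite all_rcons => /andP[/= xM sM]; move: (IHs sM) => {}IHs.
have ins_end : ins M (size s).+1 (rcons s x) = rcons (rcons s x) M.
  by rewrite -(size_rcons s x) ins_size.
rewrite size_rcons big_ord_recr /= ins_end (npairs_rcons _ _ M).
have -> : count (fun y => (M < y)%R) (rcons s x) = 0%N.
  apply/eqP; rewrite -leqn0 leqNgt -has_count -all_predC /= all_rcons /=.
  rewrite ltNge ltW //=; apply: sub_all sM => y /= yM.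
  by rewrite ltNge ltW.
rewrite addn0 [in RHS]big_ord_recl expr0 mulrDr mulr1 addrC; congr (_ + _).
under eq_bigr => p _.
  rewrite (ins_rcons _ _ (ltn_ord p)) npairs_rcons (seq.permP (perm_ins _ _ _)) /=.
  rewrite xM exprD.
  over.
rewrite -mulr_suml IHs npairs_rcons exprD exprS.
under [in RHS]eq_bigr => i _ do rewrite exprS.
by rewrite -mulr_sumr exprD expr0; ring.
Qed.

(** MacMahon: both generating functions satisfy the same recursion on the
    largest letter. *)
Lemma sum_maj_inv s : uniq s ->
  \sum_(t <- permutations s) q ^+ maj t = \sum_(t <- permutations s) q ^+ inv t.
Proof.
move=> s_uniq; pose u := sort <=%R s.
have eq_us : perm_eq (permutations s) (permutations u).
  by apply: perm_permutations; rewrite perm_sym perm_sort.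
rewrite !(perm_big _ eq_us) /=.
have: sorted <%R u by rewrite sort_lt_sorted.
elim/last_ind: u {eq_us} => [|u M IHu] su.
  by rewrite !big_seq1 /maj big_geq.
have [{}su uM] : sorted <%R u /\ all (< M) u.
  move: su; rewrite !(sorted_pairwise lt_trans) -cats1 pairwise_cat allrel1r.
  by case/and3P.
have nuM : M \notin u by apply/negP => /(allP uM) /=; rewrite ltxx.
rewrite !(perm_big _ (perm_permutations_rcons nuM)) !big_allpairs_dep.
transitivity (\sum_(t <- permutations u)
                q ^+ maj t * \sum_(i < (size u).+1) q ^+ i).
  rewrite big_seq [in RHS]big_seq; apply: eq_bigr => t.
  rewrite mem_permutations => eq_tu; rewrite -(perm_size eq_tu).
  rewrite -(@sum_ins_maj M) ?(perm_all _ eq_tu) //.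
  by rewrite -(big_mkord xpredT (fun p => q ^+ maj (ins M p t)))
    /index_iota subn0.
rewrite -mulr_suml IHu // mulr_suml big_seq [in RHS]big_seq; apply: eq_bigr => t.
rewrite mem_permutations => eq_tu; rewrite -(perm_size eq_tu).
rewrite -(@sum_ins_inv M) ?(perm_all _ eq_tu) //.
by rewrite -(big_mkord xpredT (fun p => q ^+ inv (ins M p t)))
  /index_iota subn0.
Qed.
End MacMahon.

(** * The negative part of dmaj *)

Lemma big_Neg (R : Type) (idx : R) (op : R -> R -> R) (F : int -> R) s :
  \big[op/idx]_(i <- Neg s) F (entry s i) =
  \big[op/idx]_(x <- s | (x < 0)%R) F x.
Proof.
rewrite big_filter [RHS](big_nth 0%R).
rewrite -[1%N]addn0 iotaDl big_map /index_iota subn0.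
by apply: eq_bigr.
Qed.

Lemma size_Neg s : size (Neg s) = count (fun x => x < 0)%R s.
Proof. by rewrite -sum1_size (big_Neg _ _ (fun=> 1%N)) sum1_count. Qed.

(** When absolute values increase along the sequence, the sign of a sum of two
    entries is the sign of the later one; so the entry - k, at position k, forms
    negative sums with the k - 1 entries before it. *)
Lemma nsp_abs_iota s : map absz s = iota 1 (size s) ->
  Posz (nsp s) = (\sum_(x <- s | x < 0) (- x - 1))%R.
Proof.
elim/last_ind: s => [|s x IHs]; first by rewrite big_nil.
rewrite size_rcons -[(size s).+1]addn1 iotaD map_rcons add1n cats1.
case/rcons_inj=> eq_s eq_x.
rewrite npairs_rcons PoszD IHs // -[in RHS]cats1 big_cat /=.
rewrite [X in _ = (_ + X)%R]big_mkcond big_seq1.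
have -> : count (fun y => y + x < 0)%R s = ((x < 0)%R * size s)%N.
  have sP y : y \in s -> (`|y| <= size s)%N.
    by move/(map_f absz); rewrite eq_s mem_iota; lia.
  case: (ltP x 0%R) => [x_lt0|x_ge0].
    rewrite mul1n; apply/eqP; rewrite -all_count; apply/allP => y /sP; lia.
  apply/eqP; rewrite mul0n -leqn0 leqNgt -has_count; apply/hasPn => y /sP; lia.
by congr (_ + _)%R; case: ifP => x_lt0; lia.
Qed.

(** Neither side depends on the order of the entries, so they may be sorted by
    absolute value. *)
Lemma nsp_Neg n s : perm_eq (map absz s) (iota 1 n) ->
  Posz (nsp s) = (- \sum_(i <- Neg s) entry s i - Posz (size (Neg s)))%R.
Proof.
move=> s_abs; have -> : (- \sum_(i <- Neg s) entry s i - Posz (size (Neg s)))%R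
    = (\sum_(x <- s | x < 0) (- x - 1))%R.
  rewrite (big_Neg _ _ id) big_split /= sumrN; congr (_ + _)%R.
  rewrite sumrN -sum1_size (big_Neg _ _ (fun=> 1%N)).
  by rewrite (big_morph Posz PoszD (erefl _)).
pose u := sort (relpre absz leq) s.
have us: perm_eq u s by rewrite perm_sort.
rewrite -(nsp_perm us) -(perm_big _ us); apply: nsp_abs_iota.
have u_abs: perm_eq (map absz u) (iota 1 n).
  by rewrite (perm_trans _ s_abs) ?perm_map.
rewrite -(size_map absz u) (perm_size u_abs) size_iota.
apply: (sorted_eq leq_trans anti_leq) => //; last exact: iota_sorted.
by rewrite sorted_map sort_sorted // => x y; apply: leq_total.
Qed.
Lemma maj_sorted s : sorted <%R s -> maj s = 0%N.
Proof.
move=> ss; rewrite /maj big_nat_cond big_pred0 // => -[|i] //=.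
apply/negbTE/negP => /andP[lt_is]; rewrite /entry /= lt_sorted_ltn_nth ?inE //.
  by rewrite ltnNge leqnSn.
exact: ltnW.
Qed.

Lemma nsp_ge0 s : all (>= 0)%R s -> nsp s = 0%N.
Proof.
elim: s => //= x s IHs /andP[x_ge0 s_ge0]; rewrite IHs // addn0.
apply/eqP; rewrite -leqn0 leqNgt -has_count; apply/hasPn => y /(allP s_ge0) /=.
lia.
Qed.

(** * Generalities on groups *)

(** A function that vanishes at 1, rises by at most one along each generator
    and can always be lowered away from 1 is the word length; the last condition
    also shows that S generates the whole group. *)
Lemma lengthE (gT : finGroupType) (S : {set gT}) (L : gT -> nat) :
    L 1 = 0%N ->
    (forall w s, s \in S -> (L (w * s)%g <= (L w).+1)%N) ->
    (forall w, w != 1 -> exists v s, [/\ s \in S, w = v * s & (L v < L w)%N]) ->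
  forall w, length S w = L w.
Proof.
move=> L1 L_up L_down w.
have le_word k t : is_word S t k -> (L t <= k)%N.
  case/existsP=> -[u /= /eqP <-] /andP[/allP uS /eqP <-].
  elim/last_ind: u uS => [|r s IHr] rS; first by rewrite big_nil L1.
  rewrite -cats1 big_cat big_seq1 cats1 size_rcons.
  rewrite (leq_trans (L_up _ _ _)) ?rS ?mem_rcons ?mem_head //.
  rewrite ltnS IHr // => z zr.
  by rewrite rS // mem_rcons inE zr orbT.
have [t [tS tw tL]] : exists t,
    [/\ all [in S] t, \prod_(s <- t) s = w & (size t <= L w)%N].
  move: {2}(L w).+1 (ltnSn (L w)) => m.
  elim: m w => // m IHm w; rewrite ltnS => le_m.
  have [->|/L_down[v [s [sS eq_w ltL]]]] := eqVneq w 1.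
    by exists [::]; rewrite big_nil.
  have [|t [tS tv le_t]] := IHm v; first exact: leq_trans ltL le_m.
  exists (rcons t s); rewrite all_rcons sS tS -cats1 big_cat big_seq1 tv eq_w.
  rewrite size_cat addn1.
  by split=> //; rewrite -eq_w; apply: leq_ltn_trans ltL.
have Sw : w \in <<S>>.
  rewrite -tw big_seq group_prod // => s st; rewrite mem_gen //.
  exact: (allP tS).
have [w_word w_min] := lengthP Sw.
apply/eqP; rewrite eqn_leq le_word // andbT (leq_trans _ tL) // w_min //.
by apply/existsP; exists (in_tuple t); rewrite tS /= tw.
Qed.

Lemma eq_sum_lcosets (gT : finGroupType) (G : {group gT}) (R : nmodType)
    (F1 F2 : gT -> R) :
    (forall w, \sum_(v in G) F1 (w * v)%g = \sum_(v in G) F2 (w * v)%g)%R ->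
  (\sum_w F1 w = \sum_w F2 w)%R.
Proof.
move=> eqF; rewrite !(partition_big (fun w => w *: G) xpredT) //=.
apply: eq_bigr => A _; case: (pickP (fun w => w *: G == A)) => [w0 /eqP <-|A0];
  last by rewrite !big_pred0.
have coset_sum F : (\sum_(w | (w *: G == w0 *: G)%g) F w
                     = \sum_(v in G) F (w0 * v)%g :> R)%R.
  rewrite (reindex_inj (mulgI w0)); apply: eq_bigl => v.
  by rewrite (sameP eqP lcoset_eqP) mem_lcoset mulKg.
by rewrite !coset_sum.
Qed.

Lemma sum_subg (gT : finGroupType) (G : {group gT}) (R : nmodType)
    (F : gT -> R) :
  (\sum_(v in G) F v = \sum_(u : [subg G]) F (sgval u))%R.
Proof.
rewrite (reindex_onto sgval (subg G)); last exact: subgK.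
by apply: eq_bigl => u; rewrite subgP sgvalK eqxx.
Qed.

(** * Windows under multiplication *)

Section Windows.
Variable n : nat.
Implicit Types (w v s : SD n) (t p : seq int) (x y : int).

(** The odd extension of k |-> t(k) to the nonzero integers, the way a signed
    permutation is recovered from its window t. *)
Definition signed_apply t x : int :=
  if x is Posz k then entry t k else (- entry t `|x|)%R.

Lemma size_window w : size (window w) = n.
Proof. by rewrite size_map size_enum_ord. Qed.

Lemma entry_window w (i : 'I_n) :
  entry (window w) i.+1 = letter_val (val w (false, i)).
Proof. by rewrite /entry (nth_map i) ?size_enum_ord //= nth_ord_enum. Qed.

Lemma window_mul w v :
  window (w * v) = map (signed_apply (window w)) (window v).
Proof.
rewrite /window /perm_window -map_comp; apply: eq_map => i.
rewrite SD_mulE /=; case: (val v (false, i)) => b j.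
have [wN _] := even_signedP _ (valP w).
rewrite signed_false // -/(perm_window _) -/(window _).
have := entry_window w j; case: (val w _) => c k /= eq_e.
case: b; rewrite /signed_apply /letter_val /= ?NegzE /= eq_e;
  by case: c {eq_e} => //=; rewrite opprK.
Qed.

Lemma abs_window w : perm_eq (map absz (window w)) (iota 1 n).
Proof.
have [wN _] := even_signedP _ (valP w).
have abs_eq : map absz (window w)
    = [seq (val w (false, i)).2.+1 | i <- enum 'I_n].
  by rewrite -map_comp; apply: eq_map => i /=; case: (val w _) => [[] j].
have u : uniq (map absz (window w)).
  rewrite abs_eq map_inj_uniq ?enum_uniq // => i j [/val_inj eq2].
  have: val w (false, i) = val w (false, j) \/
        val w (false, i) = val w (true, j).
    rewrite (signed_false wN (true, j)) /=; case: (val w _) eq2 => b k /= ->.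
    by case: (val w _) => [[] l]; case: b; auto.
  by case=> /perm_inj[].
apply: uniq_perm => //; first exact: iota_uniq.
apply: (uniq_min_size u _ _).2; last by rewrite size_map size_window size_iota.
move=> k; rewrite abs_eq => /mapP[i _ ->]; rewrite mem_iota /=.
by rewrite add1n ltnS ltn_ord.
Qed.

Lemma uniq_window w : uniq (window w).
Proof.
by apply: (@map_uniq _ _ absz); rewrite (perm_uniq (abs_window w)) iota_uniq.
Qed.

Lemma window_neq w p x y t : window w = p ++ [:: x, y & t] -> x != y.
Proof.
move=> eq_w; have := uniq_window w; rewrite eq_w cat_uniq /= inE.
by case: eqP => //= _; rewrite !andbF.
Qed.

Lemma window1 : window (1 : SD n) = map Posz (iota 1 n).
Proof.
rewrite /window /perm_window -[1%N]addn0 iotaDl -val_enum_ord -!map_comp.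
by apply: eq_map => i /=; rewrite perm1.
Qed.

Lemma sorted_window1 : sorted <%R (window (1 : SD n)).
Proof. by rewrite window1 sorted_map iota_ltn_sorted. Qed.

Lemma window1_ge0 : all (>= 0)%R (window (1 : SD n)).
Proof. by rewrite window1 all_map; apply/allP. Qed.

(** The window of 1 is the only increasing arrangement of 1, ..., n. *)
Lemma sorted_ge0_window w :
  sorted <%R (window w) -> all (>= 0)%R (window w) -> w = 1.
Proof.
move=> w_sorted w_ge0; apply: window_inj.
apply: (irr_sorted_eq lt_trans ltxx w_sorted sorted_window1); apply: perm_mem.
rewrite window1 (_ : window w = map Posz (map absz (window w))).
  by rewrite perm_map // abs_window.
rewrite -map_comp -[LHS]map_id; apply/eq_in_map => x /(allP w_ge0) /= ?; lia.
Qed.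

Lemma map_entry t m k : (m + k <= size t)%N ->
  map (entry t) (iota m.+1 k) = take k (drop m t).
Proof.
move=> le_t; rewrite -add1n iotaDl -map_comp; apply: map_nth_iota; lia.
Qed.

Lemma window_mul_s w s p x y t : window w = p ++ [:: x, y & t] ->
  window s = s_window n (size p).+1 -> window (w * s) = p ++ [:: y, x & t].
Proof.
move=> eq_w eq_s; rewrite window_mul eq_s /s_window -map_comp.
have := size_window w; rewrite eq_w !size_cat /= => sz_n.
rewrite !map_cat /= !(eq_map (g := entry (p ++ [:: x, y & t]))) //.
congr (_ ++ [:: _, _ & _]).
- by rewrite map_entry ?size_cat ?leq_addr // drop0 take_size_cat.
- by rewrite /entry /= nth_cat ltnNge leqnSn subSnn.
- by rewrite /entry /= nth_cat ltnn subnn.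
rewrite map_entry ?size_cat /=; last lia.
rewrite -cat_rcons -cat_rcons drop_size_cat ?size_rcons // take_oversize //; lia.
Qed.

Lemma window_mul_s0 w s x y t : window w = [:: x, y & t] ->
  window s = s0_window n -> window (w * s) = [:: - y, - x & t]%R.
Proof.
move=> eq_w eq_s; rewrite window_mul eq_s /s0_window map_cat /= -map_comp eq_w.
have := size_window w; rewrite eq_w /= => sz_n.
do 2 congr cons; rewrite (eq_map (g := entry [:: x, y & t])) //.
rewrite map_entry /=; last lia.
rewrite drop0 take_oversize //; lia.
Qed.

(** The exchange is undone by the same generator s, so w itself is a product
    v s: the form needed to descend in length. *)
Lemma ex_J_swap w p x y t : window w = p ++ [:: x, y & t] ->
  exists v s, [/\ s \in SD_J n, w = v * s & window v = p ++ [:: y, x & t]].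
Proof.
move=> eq_w; have := size_window w; rewrite eq_w size_cat /= => sz_n.
have lt_p : ((size p).+1 < n)%N by lia.
have [//|s eq_s] := @ex_s_window n (Ordinal lt_p).
have eq_ws := window_mul_s eq_w eq_s.
exists (w * s), s; split=> //; last first.
  by apply: window_inj; rewrite (window_mul_s eq_ws).
by rewrite inE; apply/existsP; exists (Ordinal lt_p); rewrite eq_s eqxx.
Qed.

Lemma J_swap w s : s \in SD_J n -> exists p x y t,
  window w = p ++ [:: x, y & t] /\ window (w * s) = p ++ [:: y, x & t].
Proof.
rewrite inE => /existsP[[i lt_in] /= /andP[i_gt0 /eqP eq_s]].
have eq_p : size (take i.-1 (window w)) = i.-1.
  by rewrite size_takel // size_window; lia.
have: size (drop i.-1 (window w)) = (n - i.-1)%N by rewrite size_drop size_window.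
case eq_d: (drop i.-1 _) => [|x [|y t]] /=; [lia | lia | move=> _].
have eq_w : window w = take i.-1 (window w) ++ [:: x, y & t].
  by rewrite -eq_d cat_take_drop.
exists (take i.-1 (window w)), x, y, t; split=> //.
by apply: (window_mul_s eq_w); rewrite eq_p prednK.
Qed.

Lemma inv_swap p x y t : (x < y)%R ->
  inv (p ++ [:: y, x & t]) = (inv (p ++ [:: x, y & t])).+1.
Proof.
move=> xy; have := npairs_swap (fun a b => b < a)%R p x y t => /=.
by rewrite xy ltNge ltW //=; lia.
Qed.

Lemma inv_swap_le p x y t :
  (inv (p ++ [:: y, x & t]) <= (inv (p ++ [:: x, y & t])).+1)%N.
Proof.
have := npairs_swap (fun a b => b < a)%R p x y t => /=.
by case: (x < y)%R; case: (y < x)%R; lia.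
Qed.

Lemma perm_swap p x y t : perm_eq (p ++ [:: y, x & t]) (p ++ [:: x, y & t]).
Proof.
by rewrite perm_cat2l -![[:: _, _ & t]]/([:: _] ++ [:: _] ++ t) perm_catCA.
Qed.

(** * Lengths, cosets and longest elements *)

Definition dlength t := (inv t + nsp t)%N.

(** With -x > z being the same as x + z < 0, the sign change and exchange of
    the first two entries trades the inversions of x with a later z for its
    negative sums and conversely; only the pair x, y itself changes status, from
    negative to positive sum or back. *)
Lemma dlength_s0 x y t :
  (dlength [:: - y, - x & t]%R + (x + y < 0)%R =
   dlength [:: x, y & t] + (0 < x + y)%R)%N.
Proof.
rewrite /dlength /=.
have flip (a : int) :
    count (fun z : int => z < - a)%R t = count (fun z : int => a + z < 0)%R t.
  by apply: eq_count => z /=; lia.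
(* The first two instances turn new inversions into old negative sums, the
   last two, read backwards, new negative sums into old inversions. *)
have := (flip x, flip y, flip (- x)%R, flip (- y)%R).
rewrite !opprK => -[[[-> ->] <-] <-].
have -> : (- x < - y)%R = (y < x)%R by lia.
have -> : (- y - x < 0)%R = (0 < x + y)%R by lia.
lia.
Qed.

Lemma J_perm w v : v \in <<SD_J n>> -> perm_eq (window (w * v)) (window w).
Proof.
(* The elements with this property form a subgroup that contains J. *)
pose H := [set v : SD n |
  [forall w : SD n, perm_eq (window (w * v)) (window w)]].
have gH : group_set H.
  apply/group_setP; split=> [|a b].
    by rewrite inE; apply/forallP => u; rewrite mulg1.
  rewrite !inE => /forallP Ha /forallP Hb; apply/forallP => u.
  by rewrite mulgA (perm_trans (Hb _)).
move=> vJ; suff: v \in Group gH by rewrite inE => /forallP.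
apply: subsetP vJ; rewrite gen_subG; apply/subsetP => s sJ.
rewrite inE; apply/forallP => u; have [p [x [y [t [-> ->]]]]] := J_swap u sJ.
exact: perm_swap.
Qed.

(** Bubble sort: exchanging an adjacent descent removes exactly one inversion. *)
Lemma J_sort w : exists2 v, v \in <<SD_J n>> & sorted <%R (window (w * v)).
Proof.
move: {2}(inv (window w)).+1 (ltnSn (inv (window w))) => m.
elim: m w => // m IHm w; rewrite ltnS => le_m.
have [ws|/unsorted[p [x [y [t [eq_w]]]]]] := boolP (sorted <%R (window w)).
  by exists 1; rewrite ?group1 ?mulg1.
rewrite -leNgt le_eqVlt eq_sym (negbTE (window_neq eq_w)) /= => lt_yx.
have [v [s [sJ eq_wv eq_v]]] := ex_J_swap eq_w.
have [|u uJ us] := IHm v.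
  by move: le_m; rewrite eq_w eq_v (inv_swap _ _ lt_yx).
exists (s^-1 * u); first by rewrite groupM // groupV mem_gen.
by rewrite eq_wv mulgA mulgK.
Qed.

(** Bubble sort of t, undone by right multiplications, starting from the
    sorted window in the coset of w. *)
Lemma J_transitive w t : perm_eq t (window w) ->
  exists2 v, v \in <<SD_J n>> & window (w * v) = t.
Proof.
move: {2}(inv t).+1 (ltnSn (inv t)) => m.
elim: m t => // m IHm t; rewrite ltnS => le_m eq_t.
have [ts|/unsorted[p [x [y [t' [def_t]]]]]] := boolP (sorted <%R t).
  have [v vJ vs] := J_sort w; exists v => //.
  apply: (irr_sorted_eq lt_trans ltxx vs ts); apply: perm_mem.
  by rewrite (perm_trans (J_perm _ vJ)) // perm_sym.
have neq_xy : x != y.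
  have := perm_uniq eq_t; rewrite uniq_window def_t cat_uniq /= inE.
  by case: eqP => //= _; rewrite !andbF.
rewrite -leNgt le_eqVlt eq_sym (negbTE neq_xy) /= => lt_yx.
have [||v vJ eq_v] := IHm (p ++ [:: y, x & t']).
- by move: le_m; rewrite def_t (inv_swap _ _ lt_yx).
- by rewrite (perm_trans (perm_swap _ _ _ _)) // -def_t.
have [u [s [sJ eq_u eq_uw]]] := ex_J_swap eq_v.
exists (v * s^-1); first by rewrite groupM // groupV mem_gen.
by rewrite mulgA eq_u mulgK eq_uw def_t.
Qed.

Lemma sum_J (R : nmodType) (F : seq int -> R) w :
  (\sum_(v : [subg <<SD_J n>>]) F (window (w * sgval v)%g)
   = \sum_(t <- permutations (window w)) F t)%R.
Proof.
rewrite -(big_map (fun v : [subg <<SD_J n>>] => window (w * sgval v)) xpredT F).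
apply: perm_big; apply: uniq_perm; rewrite ?permutations_uniq //.
  rewrite map_inj_uniq ?index_enum_uniq // => u v /window_inj /mulgI.
  exact: val_inj.
move=> t; rewrite mem_permutations; apply/mapP/idP => [[v _ ->]|].
  exact/J_perm/subgP.
case/J_transitive=> v vJ <-; exists (subg _ v); first exact: mem_index_enum.
by rewrite subgK.
Qed.

Lemma length_J (v : [subg <<SD_J n>>]) :
  length (parabolic_gens (SD_J n)) v = inv (window (sgval v)).
Proof.
move: v; apply: lengthE => [|v s|v].
- by rewrite inv_sorted // sorted_window1.
- rewrite inE => /(J_swap (sgval v))[p [x [y [t [eq_v eq_vs]]]]].
  by rewrite [sgval _]/(sgval v * sgval s) eq_vs eq_v inv_swap_le.
move=> v_neq1.
have v_ge0 : all (>= 0)%R (window (sgval v)).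
  have := J_perm 1 (subgP v); rewrite mul1g => /perm_all->; exact: window1_ge0.
have [vs|/unsorted[p [x [y [t [eq_v]]]]]] := boolP (sorted <%R (window (sgval v))).
  by case/eqP: v_neq1; apply: val_inj; apply: sorted_ge0_window.
rewrite -leNgt le_eqVlt eq_sym (negbTE (window_neq eq_v)) /= => lt_yx.
have [u [s [sJ eq_us eq_u]]] := ex_J_swap eq_v.
have sG : s \in <<SD_J n>> by rewrite mem_gen.
have uG : u \in <<SD_J n>> by rewrite -(mulgK s u) -eq_us groupM ?groupV ?subgP.
exists (subg _ u), (subg _ s); rewrite inE !subgK //; split=> //.
  by apply: val_inj; rewrite /= !subgK.
by rewrite eq_v eq_u (inv_swap _ _ lt_yx).
Qed.

(** An increasing window whose first two entries have nonnegative sum can have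
    a negative entry only in first place; the number of negative entries being
    even, there is none and the element is 1.  Any other element is lowered by an
    adjacent exchange or by s_0. *)
Lemma length_D : (2 <= n)%N -> forall w, length (SD_S n) w = dlength (window w).
Proof.
move=> le2n; apply: lengthE => [|w s|w].
- by rewrite /dlength inv_sorted ?sorted_window1 // nsp_ge0 // window1_ge0.
- rewrite !inE => /orP[/eqP eq_s|sJ].
    case eq_w: (window w) (size_window w) => [|x [|y t]] /= sz; [lia | lia | ].
    rewrite (window_mul_s0 eq_w eq_s); have := dlength_s0 x y t.
    by do 2 case: (_ < _)%R; lia.
  have [|p [x [y [t [-> ->]]]]] := @J_swap w s; first by rewrite inE.
  rewrite /dlength (nsp_perm (perm_swap _ _ _ _)) -addSn leq_add2r.
  exact: inv_swap_le.
move=> w_neq1.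
have [ws|/unsorted[p [x [y [t [eq_w]]]]]] := boolP (sorted <%R (window w)); last first.
  rewrite -leNgt le_eqVlt eq_sym (negbTE (window_neq eq_w)) /= => lt_yx.
  have [u [s [sJ eq_us eq_u]]] := ex_J_swap eq_w.
  exists u, s; split=> //; first by rewrite inE sJ orbT.
  rewrite /dlength eq_w eq_u (nsp_perm (perm_swap _ _ _ _)).
  by rewrite (inv_swap _ _ lt_yx).
case eq_w: (window w) (size_window w) => [|x [|y t]] /= sz; [lia | lia | ].
have [s eq_s] := ex_s0_window le2n; have eq_ws := window_mul_s0 eq_w eq_s.
have [xy_lt0|xy_ge0] := ltP (x + y)%R 0%R.
  exists (w * s), s; split.
  - by rewrite !inE eq_s eqxx.
  - by apply: window_inj; rewrite (window_mul_s0 eq_ws eq_s) !opprK.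
  by rewrite eq_ws; have := dlength_s0 x y t; rewrite xy_lt0 ltNge ltW //=; lia.
case/eqP: w_neq1; apply: sorted_ge0_window => //.
move: ws; rewrite eq_w /= => /andP[lt_xy /(order_path_min lt_trans)/allP yt].
have t_ge0 : all (>= 0)%R t by apply/allP => z /yt; lia.
have t_neg : count (fun z => z < 0)%R t = 0%N.
  apply/eqP; rewrite -leqn0 leqNgt -has_count.
  by apply/hasPn => z /(allP t_ge0) /=; lia.
have: ~~ odd (size (Neg (window w))) by case/andP: (valP w).
rewrite size_Neg eq_w /= t_neg t_ge0 andbT.
have -> : (y < 0)%R = false by lia.
by case: (ltP x 0%R) => //= x_ge0 _; lia.
Qed.

Lemma dmajE w : dmaj (window w) = Posz (maj (window w) + nsp (window w)).
Proof. by rewrite PoszD (nsp_Neg (abs_window w)) /dmaj addrA. Qed.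

(** If position i were an ascent, multiplying by s_i would gain an inversion.
    The hypothesis speaks of inv on the coset of w only, so as to apply to the
    longest elements of S_n^D and of S_n alike. *)
Lemma longest_decreasing w :
  (forall v, v \in <<SD_J n>> -> inv (window (w * v)%g) <= inv (window w))%N ->
  sorted >%R (window w).
Proof.
move=> w_max; apply: contraT => /unsorted[p [x [y [t [eq_w]]]]].
rewrite -leNgt le_eqVlt (negbTE (window_neq eq_w)) /= => lt_xy.
have [u [s [sJ eq_us eq_u]]] := ex_J_swap eq_w.
have := w_max s^-1; rewrite groupV mem_gen // => /(_ isT).
by rewrite {1}eq_us mulgK eq_w eq_u (inv_swap _ _ lt_xy) ltnn.
Qed.

Lemma maj_mul u v : sorted <%R (window u) -> v \in <<SD_J n>> ->
  maj (window (u * v)) = maj (window v).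
Proof.
move=> us vJ; rewrite window_mul; apply: maj_map.
have vP x : x \in window v -> exists2 k, (k < n)%N & x = Posz k.+1.
  have := J_perm 1 vJ; rewrite mul1g => /perm_mem->; rewrite window1.
  case/mapP=> -[|k]; rewrite mem_iota // => lt_k ->.
  by exists k => //; lia.
move=> x y /vP[i lt_i ->] /vP[j lt_j ->]; rewrite /signed_apply /entry /=.
by rewrite lt_sorted_ltn_nth // inE size_window.
Qed.

End Windows.

Theorem proposition6p1 (n : nat) (hn : (4 <= n)%N) :
  @induced_by (SD n) (SD_S n) (SD_J n)
    (fun w => dmaj (window w))
    (fun v => Posz (maj (window (sgval v)))).
Proof.
have len_D := @length_D n (ltnW (ltnW hn)).
pose q : {fraction {poly int}} := FracField.tofrac 'X%R.
split.
- split.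
  + rewrite /equidistributed /gen_fun -/q.
    apply: (@eq_sum_lcosets _ <<SD_J n>>%G) => w; rewrite !sum_subg.
    transitivity (q ^+ nsp (window w) *
                  \sum_(t <- permutations (window w)) q ^+ maj t)%R.
      rewrite -sum_J mulr_sumr; apply: eq_bigr => v _.
      by rewrite dmajE -exprnP addnC exprD (nsp_perm (J_perm _ (subgP v))).
    rewrite sum_maj_inv ?uniq_window // -sum_J mulr_sumr; apply: eq_bigr => v _.
    by rewrite len_D -exprnP /dlength addnC exprD (nsp_perm (J_perm _ (subgP v))).
  + by rewrite dmajE maj_sorted ?sorted_window1 // nsp_ge0 // window1_ge0.
  + move=> w w_max; rewrite dmajE len_D maj_decreasing //.
    apply: longest_decreasing => v vJ; have := w_max (w * v)%g.
    by rewrite !len_D /dlength (nsp_perm (J_perm _ vJ)) leq_add2r.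
- split.
  + rewrite /equidistributed /gen_fun -/q.
    transitivity (\sum_(t <- permutations (window (1%g : SD n))) q ^+ maj t)%R.
      by rewrite -sum_J; apply: eq_bigr => v _; rewrite mul1g.
    rewrite sum_maj_inv ?uniq_window // -sum_J; apply: eq_bigr => v _.
    by rewrite mul1g length_J.
  + by rewrite maj_sorted ?sorted_window1.
  + move=> w w_max; rewrite length_J maj_decreasing //.
    apply: longest_decreasing => v vJ; have := w_max (w * subg _ v)%g.
    by rewrite !length_J /= subgK.
move=> w; have [v vJ us] := J_sort w; set u := (w * v)%g in us.
have vVJ : (v^-1 \in <<SD_J n>>)%g by rewrite groupV.
exists u, (subg _ v^-1)%g; rewrite subgK //; split; last 2 first.
- by rewrite mulgK.
- rewrite dmajE len_D /dlength inv_sorted // add0n addnC PoszD.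
  rewrite -[w in LHS](mulgK v) (nsp_perm (J_perm _ vVJ)) -/u; congr (_ + _)%R.
  by rewrite maj_mul.
rewrite inE; apply/forallP => s; apply/implyP => sJ.
have [p [x [y [t [eq_u eq_us]]]]] := J_swap u sJ.
rewrite !len_D eq_us eq_u /dlength (nsp_perm (perm_swap _ _ _ _)) ltn_add2r.
have lt_xy : (x < y)%R.
  move: us; rewrite eq_u (sorted_pairwise lt_trans) pairwise_cat /=.
  by case/and3P=> _ _ /andP[/andP[]].
by rewrite (inv_swap _ _ lt_xy).
Qed.
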